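(* If $C\subset\mathbb{R}^n$ is a polytope, then the following hold: (1) Let $p$ be the size of a largest antichain of faces of $C$ (i.e., a largest set of faces such that no one is contained in another). Then $\mathrm{rank}_+(C)$ is bounded below by the smallest $k$ such that $p\le \binom{k}{\lfloor k/2\rfloor}$. (2) Let $n_C$ be the number of faces of $C$. Then $\mathrm{rank}_+(C)\ge \log_2(n_C)$.
   Context: Polytopes are assumed full-dimensional with the origin in their interior. The faces of $C$ are the elements of its face lattice, so they include the empty face and $C$ itself (for example, a square has $10$ faces). $C^\circ=\{y\in\mathbb{R}^n : \langle x,y\rangle\le1\ \forall x\in C\}$ is the polar of $C$, and $\mathrm{ext}(\cdot)$ denotes the set of extreme points. The slack operator is $S_C:\mathrm{ext}(C)\times\mathrm{ext}(C^\circ)\to\mathbb{R}$, $S_C(x,y)=1-\langle x,y\rangle$; since $C$ is a polytope, it can be identified with a finite nonnegative matrix with rows indexed by $\mathrm{ext}(C)$ (the vertices of $C$) and columns indexed by $\mathrm{ext}(C^\circ)$ (in bijection with the facets of $C$), called the canonical slack matrix of $C$. $\mathbb{R}^i_+$ is the nonnegative orthant in $\mathbb{R}^i$. The nonnegative rank $\mathrm{rank}_+(C)$ is the smallest $i$ such that there are maps $A:\mathrm{ext}(C)\to\mathbb{R}^i_+$ and $B:\mathrm{ext}(C^\circ)\to\mathbb{R}^i_+$ with $S_C(x,y)=\langle A(x),B(y)\rangle$ for all $(x,y)\in\mathrm{ext}(C)\times\mathrm{ext}(C^\circ)$; equivalently, the smallest $i$ such that the canonical slack matrix of $C$ is a product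 of a nonnegative matrix with $i$ columns and a nonnegative matrix with $i$ rows. *)

(* Defs.v *)
From mathcomp Require Import all_boot all_order all_algebra.
From mathcomp Require Import finmap.
From mathcomp Require Import all_classical all_reals all_analysis.
From mathcomp Require Import lra.
Set Implicit Arguments.
Unset Strict Implicit.
Unset Printing Implicit Defensive.
Import Order.TTheory GRing.Theory Num.Theory.
Import numFieldNormedType.Exports.
Local Open Scope classical_set_scope.
Local Open Scope ring_scope.

Definition dot (R : realType) (n : nat) (x y : 'rV[R]_n) : R :=
  \sum_(i < n) x 0 i * y 0 i.

Definition nonneg_vec (R : realType) (n : nat) (x : 'rV[R]_n) : Prop :=
  forall i, 0 <= x 0 i.

Definition conv_hull (R : realType) (n k : nat) (v : 'I_k -> 'rV[R]_n) :
    set 'rV[R]_n :=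
  [set x | exists w : 'rV[R]_k, [/\ nonneg_vec w, \sum_i w 0 i = 1 &
                                    x = \sum_i w 0 i *: v i]].

Lemma dot_sumr (R : realType) (n k : nat) (a : 'rV[R]_n) (w : 'I_k -> R)
    (v : 'I_k -> 'rV[R]_n) :
  dot a (\sum_i w i *: v i) = \sum_i w i * dot a (v i).
Proof.
rewrite /dot; under eq_bigr => j _ do rewrite summxE mulr_sumr.
rewrite exchange_big /=; apply: eq_bigr => i _; rewrite mulr_sumr.
by apply: eq_bigr => j _; rewrite mxE mulrCA.
Qed.

Lemma dotC (R : realType) (n : nat) (x y : 'rV[R]_n) : dot x y = dot y x.
Proof. by apply: eq_bigr => i _; rewrite mulrC. Qed.

Lemma conv_hull_vertex (R : realType) (n k : nat) (v : 'I_k -> 'rV[R]_n) i :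
  conv_hull v (v i).
Proof.
exists (delta_mx 0 i); split.
- by move=> j; rewrite mxE eqxx; case: eqVneq.
- by rewrite (bigD1 i)//= mxE !eqxx big1 ?addr0// => j /negPf ji; rewrite mxE ji.
- rewrite (bigD1 i)//= mxE !eqxx scale1r big1 ?addr0// => j /negPf ji.
  by rewrite mxE ji scale0r.
Qed.

(* [interior C 0] also makes [C] full-dimensional. *)
Definition polytope (R : realType) (n : nat) (C : set 'rV[R]_n) : Prop :=
  (exists (k : nat) (v : 'I_k -> 'rV[R]_n), C = conv_hull v) /\ interior C 0.

Definition polar (R : realType) (n : nat) (C : set 'rV[R]_n) : set 'rV[R]_n :=
  [set y | forall x, C x -> dot x y <= 1].

Definition ext (R : realType) (n : nat) (C : set 'rV[R]_n) : set 'rV[R]_n :=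
  [set x | C x /\
    forall y z t, C y -> C z -> 0 < t < 1 -> x = t *: y + (1 - t) *: z ->
    y = x /\ z = x].

Definition slack (R : realType) (n : nat) (x y : 'rV[R]_n) : R := 1 - dot x y.

(* A face of C is the set where an inequality <a, .> <= b valid on C is tight;
   a = 0 gives the empty face (b = 1) and C itself (b = 0). *)
Definition faces (R : realType) (n : nat) (C : set 'rV[R]_n) :
    set (set 'rV[R]_n) :=
  [set F | exists (a : 'rV[R]_n) (b : R),
    (forall x, C x -> dot a x <= b) /\ F = C `&` [set x | dot a x = b]].

Definition antichain (T : Type) (A : set (set T)) : Prop :=
  forall F G, A F -> A G -> F `<=` G -> F = G.

Lemma finite_faces (R : realType) (n : nat) (C : set 'rV[R]_n) :
  polytope C -> finite_set (faces C).
Proof.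
move=> [[k [v ->]] _].
pose g (I : {set 'I_k}) : set 'rV[R]_n :=
  [set x | exists w : 'rV[R]_k, [/\ nonneg_vec w, \sum_i w 0 i = 1,
     x = \sum_i w 0 i *: v i & forall i, i \notin I -> w 0 i = 0]].
apply: (@sub_finite_set _ _ (g @` setT)); last first.
  exact/finite_image/finite_finset.
move=> F [a [b [Hab ->]]].
exists [set i | dot a (v i) == b]%SET => //.
apply/seteqP; split=> x.
- move=> [w [w0 w1 xE wI]]; split; first by exists w; split.
  rewrite /= xE dot_sumr; transitivity (\sum_i w 0 i * b).
    apply: eq_bigr => i _; have [/eqP -> //|iI] := boolP (dot a (v i) == b).
    by rewrite wI ?mul0r// inE.
  by rewrite -mulr_suml w1 mul1r.
- move=> [[w [w0 w1 xE]] /=]; rewrite xE dot_sumr => xb.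
  exists w; split=> // i; rewrite inE => ib.
  have P j : 0 <= w 0 j * (b - dot a (v j)).
    by rewrite mulr_ge0// subr_ge0 Hab//; exact: conv_hull_vertex.
  have S0 : \sum_j w 0 j * (b - dot a (v j)) = 0.
    under eq_bigr => j _ do rewrite mulrBr.
    by rewrite sumrB xb -mulr_suml w1 mul1r subrr.
  have /eqP := psumr_eq0P (fun j _ => P j) S0 (i := i) isT.
  by rewrite mulf_eq0 subr_eq0 [b == _]eq_sym (negPf ib) orbF => /eqP.
Qed.

(* [fset_set] is the empty set on infinite sets; see [finite_faces]. *)
Definition num_faces (R : realType) (n : nat) (C : set 'rV[R]_n) : nat :=
  #|` fset_set (faces C)|%fset.

Definition max_antichain (R : realType) (n : nat) (C : set 'rV[R]_n) : nat :=
  (\max_(A <- fpowerset (fset_set (faces C)) | `[< antichain [set` A] >])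
    #|` A|)%N.

(* A and B are only constrained on ext C and ext (polar C) respectively. *)
Definition nonneg_factorization (R : realType) (n : nat) (C : set 'rV[R]_n)
    (i : nat) : Prop :=
  exists A B : 'rV[R]_n -> 'rV[R]_i,
    [/\ forall x, ext C x -> nonneg_vec (A x),
        forall y, ext (polar C) y -> nonneg_vec (B y) &
        forall x y, ext C x -> ext (polar C) y ->
          slack x y = dot (A x) (B y)].

Lemma nonneg_factorization_exists (R : realType) (n : nat)
    (C : set 'rV[R]_n) : polytope C -> exists i, nonneg_factorization C i.
Proof.
move=> [[k [v ->]] _]; exists k.
have /choice[A HA] : forall x, exists w : 'rV[R]_k, conv_hull v x ->
    [/\ nonneg_vec w, \sum_i w 0 i = 1 & x = \sum_i w 0 i *: v i].
  by move=> x; have [[w ?]|?] := pselect (conv_hull v x); [exists w|exists 0].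
exists A, (fun y => \row_i (1 - dot (v i) y)); split.
- by move=> x [/HA[]].
- move=> y [py _] i; rewrite mxE subr_ge0.
  by apply: py; exact: conv_hull_vertex.
- move=> x y [/HA[_ w1 xE] _] _; rewrite /slack {1}xE dotC dot_sumr /dot.
  under [RHS]eq_bigr => i _ do rewrite mxE mulrBr mulr1.
  rewrite sumrB w1; congr (_ - _).
  by apply: eq_bigr => i _; rewrite -![\sum_(_ < _) _]/(dot _ _) dotC.
Qed.

(* The default value 0 is never used for a polytope: see
   [nonneg_factorization_exists]. *)
Definition nonneg_rank (R : realType) (n : nat) (C : set 'rV[R]_n) : nat :=
  if pselect (exists i, `[< nonneg_factorization C i >]) is left h
  then ex_minn h else 0%N.

Lemma sperner_exists (p : nat) : exists k, (p <= 'C(k, k./2))%N.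
Proof.
have leb q j : (0 < j < q -> q <= 'C(q, j))%N.
  elim: q j => [|q IHq] [|j] //; rewrite !ltnS /= => jq.
  rewrite binS; case: (ltngtP j.+1 q) jq => // [jq _|jq _].
  - by rewrite -addn1 leq_add ?IHq// bin_gt0 ltnW// ltnW.
  - by rewrite -jq binn binSn.
exists p; case: p => [|[|p]] //; apply: leb => /=.
by rewrite !ltnS leq_half_double -addnn leqW ?leq_addr.
Qed.

Definition sperner_index (p : nat) : nat := ex_minn (sperner_exists p).

(* Main.v *)
(* Given a nonnegative factorization S_C(x, y) = <A(x), B(y)> of size k, send a
   face F to the set of indices i such that A(x)_i > 0 for some vertex x of F.
   This map from faces to subsets of {1, ..., k} reflects inclusion: if the
   image of F lies in that of G, then for every facet y containing G the vector
   B(y) vanishes on the image of G, hence <A(x), B(y)> = 0 for all vertices x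
   of F, so y contains F; and G is the intersection of the facets containing
   it. Hence there are at most 2^k faces, and antichains of faces map to
   antichains of subsets, which Sperner's theorem bounds. *)
Require Import Defs.
From mathcomp Require Import all_boot all_order all_algebra.
From mathcomp Require Import all_classical all_reals all_analysis.
From mathcomp Require Import finmap zify ring lra.
Set Implicit Arguments.
Unset Strict Implicit.
Unset Printing Implicit Defensive.
Import Order.TTheory GRing.Theory Num.Theory.
Import numFieldNormedType.Exports.

(** * Sperner's theorem, by counting with factorials *)

Lemma leq_fact_balance (a b d : nat) :
  a <= b -> (a + d)`! * b`! <= a`! * (b + d)`!.
Proof.
move=> ab; elim: d => [|d IHd]; first by rewrite !addn0.
rewrite !addnS !factS -mulnA [leqRHS]mulnCA leq_mul//.
by rewrite ltnS leq_add2r.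
Qed.

(** This is maximality of the central binomial coefficient, in a form free of division. By symmetry
    [m] is at most [n./2], and moving two factorials apart at constant sum increases their
    product. *)
Lemma leq_fact_half (n m : nat) :
  m <= n -> (n./2)`! * (n - n./2)`! <= m`! * (n - m)`!.
Proof.
wlog mn : m / m <= n./2.
  move=> H mn; have [/H->//|] := leqP m n./2 => nm.
  have := H (n - m); rewrite subKn// [(n - m)`! * _]mulnC; apply; lia.
move=> _; have := @leq_fact_balance m (n - n./2) (n./2 - m).
rewrite subnKC// (_ : n - n./2 + (n./2 - m) = n - m); last lia.
apply; lia.
Qed.

(* Inductive form of the Lubell-Yamamoto-Meshalkin inequality: a proper subset
   [A] of [X] lies in [X :\ x] for exactly [#|X| - #|A|] elements [x] of [X]. *)
Lemma antichain_sum_fact (T : finType) (S : {set {set T}}) (X : {set T}) :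
  {in S &, forall A B : {set T}, A \subset B -> A = B} ->
  \sum_(A in S | A \subset X) (#|A|)`! * (#|X| - #|A|)`! <= (#|X|)`!.
Proof.
move=> antiS; have [m] := ubnP #|X|; elim: m X => // m IHm X; rewrite ltnS => Xm.
have [XS|XnS] := boolP (X \in S).
  (* The antichain condition leaves [X] as the only term. *)
  rewrite (big_pred1 X) ?subnn ?muln1// => A /=.
  apply/andP/eqP => [[AS AX]|->//]; exact: antiS.
have ltAX A : A \in S -> A \subset X -> #|A| < #|X|.
  move=> AS AX; apply: proper_card; rewrite finset.properEneq AX andbT.
  by apply: contraNneq XnS => <-.
have cardXD1 x : x \in X -> #|X :\ x| = #|X|.-1.
  by move=> xX; rewrite [#|X|](cardsD1 x) xX.
case: (posnP #|X|) => [X0|X0].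
  by rewrite big_pred0// => A; apply/andP => -[/ltAX h /h]; rewrite X0.
apply: (@leq_trans (\sum_(x in X)
    \sum_(A in S | A \subset X :\ x) (#|A|)`! * (#|X :\ x| - #|A|)`!)).
  rewrite (exchange_big_dep (fun A => (A \in S) && (A \subset X))) /=; last first.
    by move=> x A _ /andP[-> /subsetD1P[-> _]].
  apply: leq_sum => A /andP[AS AX].
  rewrite (eq_bigl [in X :\: A]); last first.
    by move=> x; rewrite !inE AS subsetD1 AX /= andbC.
  rewrite (eq_bigr (fun=> (#|A|)`! * (#|X|.-1 - #|A|)`!)); last first.
    by move=> x; rewrite !inE => /andP[_ /cardXD1->].
  rewrite sum_nat_const cardsD (finset.setIidPr AX) mulnCA leq_mul//.
  have := ltAX _ AS AX; case: #|X| => // k; rewrite ltnS => Ak.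
  by rewrite subSn// factS.
apply: leq_trans (_ : \sum_(x in X) (#|X|.-1)`! <= _).
  apply: leq_sum => x xX.
  rewrite -(cardXD1 _ xX).
  by apply: IHm; move: Xm; rewrite (cardsD1 x) xX.
by rewrite sum_nat_const; case: #|X| X0 => // k _; rewrite factS.
Qed.

Theorem sperner (T : finType) (S : {set {set T}}) :
  {in S &, forall A B : {set T}, A \subset B -> A = B} ->
  #|S| <= 'C(#|T|, #|T|./2).
Proof.
move=> /(@antichain_sum_fact _ _ [set: T]%SET); rewrite cardsT => H.
have hn : #|T|./2 <= #|T| by lia.
(* This factor is the least possible term of the factorial sum, and it turns the binomial
   coefficient into [#|T|] factorial. *)
rewrite -(@leq_pmul2r ((#|T|./2)`! * (#|T| - #|T|./2)`!)) ?muln_gt0 ?fact_gt0//.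
rewrite bin_fact//; apply: leq_trans H; rewrite -sum_nat_const.
rewrite [leqRHS](eq_bigl (fun A => A \in S)); last by move=> A; rewrite finset.subsetT andbT.
by apply: leq_sum => A _; apply: leq_fact_half; exact: max_card.
Qed.

Local Open Scope classical_set_scope.
Local Open Scope ring_scope.

(** * Inner products, convex hulls and their extreme points *)

Lemma dotDr (R : realType) (n : nat) (a x y : 'rV[R]_n) :
  dot a (x + y) = dot a x + dot a y.
Proof.
by rewrite /dot -big_split; apply: eq_bigr => i _; rewrite mxE mulrDr.
Qed.

Lemma dotZr (R : realType) (n : nat) (a : 'rV[R]_n) (c : R) (x : 'rV[R]_n) :
  dot a (c *: x) = c * dot a x.
Proof. by rewrite /dot mulr_sumr; apply: eq_bigr => i _; rewrite mxE mulrCA. Qed.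

Lemma dot0r (R : realType) (n : nat) (a : 'rV[R]_n) : dot a 0 = 0.
Proof. by rewrite -(scale0r 0) dotZr mul0r. Qed.

Lemma dotBr (R : realType) (n : nat) (a x y : 'rV[R]_n) :
  dot a (x - y) = dot a x - dot a y.
Proof. by rewrite -scaleN1r dotDr dotZr mulN1r. Qed.

Lemma dot_gt0 (R : realType) (n : nat) (d : 'rV[R]_n) : d != 0 -> 0 < dot d d.
Proof.
move=> /rV0Pn[i di]; rewrite /dot (bigD1 i)//= ltr_pwDl//.
  by rewrite lt_def mulf_neq0//= -expr2 sqr_ge0.
by apply: sumr_ge0 => j _; rewrite -expr2 sqr_ge0.
Qed.

Lemma dot_conv_hull_le (R : realType) (n k : nat) (v : 'I_k -> 'rV[R]_n)
    (a x : 'rV[R]_n) (b : R) :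
  (forall i, dot a (v i) <= b) -> conv_hull v x -> dot a x <= b.
Proof.
move=> Hb [w [w0 w1 ->]]; rewrite dot_sumr.
apply: (@le_trans _ _ (\sum_i w 0 i * b)).
  by apply: ler_sum => i _; rewrite ler_wpM2l.
by rewrite -mulr_suml w1 mul1r.
Qed.

Lemma dot_conv_hull_lt (R : realType) (n k : nat) (v : 'I_k -> 'rV[R]_n)
    (a x : 'rV[R]_n) (b : R) :
  conv_hull v x -> b < dot a x -> exists i, b < dot a (v i).
Proof.
move=> vx bx; apply/not_existsP => H; move: bx; apply/negP; rewrite -leNgt.
by apply: dot_conv_hull_le vx => i; rewrite leNgt; apply/negP/H.
Qed.

(** A small positive multiple of [d] itself lies in [C]. *)
Lemma interior0_dot_gt0 (R : realType) (n : nat) (C : set 'rV[R]_n)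
    (d : 'rV[R]_n) :
  interior C 0 -> d != 0 -> exists2 x, C x & 0 < dot d x.
Proof.
move=> C0 d0.
have cd : (e *: d) @[e --> (0 : R)] --> (0 : 'rV[R]_n).
  have := @scalel_continuous R 'rV[R]_n d 0; rewrite /continuous_at scale0r.
  exact.
have : \forall e \near (0:R)^'+, C (e *: d).
  by apply: cvg_within; exact: cd.
move=> nC; near (0:R)^'+ => e.
exists (e *: d); first by near: e.
by rewrite dotZr mulr_gt0// dot_gt0.
Unshelve. all: by end_near. Qed.

(** A non-extreme generator is a convex combination of all generators with its own weight below 1;
    solving for it expresses it through the others. *)
Lemma conv_hull_drop (R : realType) (n k : nat) (v : 'I_k.+1 -> 'rV[R]_n) i :
  ~ ext (conv_hull v) (v i) -> conv_hull v = conv_hull (v \o lift i).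
Proof.
move=> nE.
have wsum (w : 'rV[R]_k.+1) :
    \sum_j w 0 j *: v j = w 0 i *: v i + \sum_j w 0 (lift i j) *: v (lift i j).
  by rewrite (bigD1_ord i).
have [c [c0 c1 ci vi]] : exists c : 'rV[R]_k.+1, [/\ nonneg_vec c,
    \sum_j c 0 j = 1, c 0 i != 1 & v i = \sum_j c 0 j *: v j].
  apply: contrapT => H; apply: nE; split; first exact: conv_hull_vertex.
  move=> y z t [al [al0 al1 yE]] [be [be0 be1 zE]] /andP[t0 t1] viE.
  have dirac (w : 'rV[R]_k.+1) : nonneg_vec w -> \sum_j w 0 j = 1 ->
      w 0 i = 1 -> \sum_j w 0 j *: v j = v i.
    move=> w0; rewrite (bigD1_ord i)//= => w1 wi.
    have /psumr_eq0P ws : \sum_j w 0 (lift i j) = 0 by lra.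
    by rewrite wsum wi scale1r big1 ?addr0// => j _; rewrite ws// scale0r.
  have le1 (w : 'rV[R]_k.+1) : nonneg_vec w -> \sum_j w 0 j = 1 -> w 0 i <= 1.
    by move=> w0 <-; rewrite (bigD1_ord i)//= lerDl sumr_ge0.
  (* Otherwise the mixture of [al] and [be] is a forbidden [c]. As both weights are at most 1, both
     equal 1, so [y] and [z] coincide with [v i]. *)
  have cE : t * al 0 i + (1 - t) * be 0 i = 1.
    apply/eqP; apply: contrapT => /negP ci; apply: H.
    exists (t *: al + (1 - t) *: be); split.
    - by move=> j; rewrite !mxE addr_ge0// mulr_ge0// ?subr_ge0 ltW.
    - under eq_bigr => j _ do rewrite !mxE.
      by rewrite big_split/= -!mulr_sumr al1 be1; lra.
    - by rewrite !mxE.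
    - rewrite {1}viE yE zE !scaler_sumr -big_split; apply: eq_bigr => j _ /=.
      by rewrite !mxE !scalerA scalerDl.
  have := le1 _ al0 al1; have := le1 _ be0 be1 => be_le al_le.
  have ali : al 0 i = 1 by nra.
  have bei : be 0 i = 1 by nra.
  by rewrite yE zE !dirac.
have ci1 : 0 < 1 - c 0 i.
  rewrite subr_gt0 lt_def eq_sym ci /=.
  by rewrite -c1 (bigD1_ord i)//= lerDl sumr_ge0.
have viE : v i = (1 - c 0 i)^-1 *: \sum_j c 0 (lift i j) *: v (lift i j).
  apply: (canRL (scalerK _)); first by rewrite gt_eqF.
  by rewrite scalerBl scale1r {1}vi wsum addrAC subrr add0r.
have c1' : \sum_j c 0 (lift i j) = 1 - c 0 i.
  by rewrite -c1 (bigD1_ord i)//= addrAC subrr add0r.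
apply/seteqP; split=> x [w [w0 w1 ->]].
  exists (\row_j (w 0 (lift i j) + w 0 i / (1 - c 0 i) * c 0 (lift i j))).
  split.
  - by move=> j; rewrite mxE addr_ge0// !mulr_ge0// invr_ge0 ltW.
  - under eq_bigr do rewrite mxE.
    rewrite big_split/= -mulr_sumr c1' divfK ?gt_eqF//.
    by rewrite -w1 (bigD1_ord i)//= addrC.
  - rewrite wsum viE scalerA scaler_sumr addrC -big_split.
    apply: eq_bigr => j _ /=.
    by rewrite mxE scalerDl scalerA.
exists (\row_j if unlift i j is Some j' then w 0 j' else 0); split.
- by move=> j; rewrite mxE; case: unliftP.
- rewrite (bigD1_ord i)//= mxE unlift_none add0r -w1.
  by apply: eq_bigr => j _; rewrite mxE liftK.
- rewrite wsum mxE unlift_none scale0r add0r.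
  by apply: eq_bigr => j _; rewrite mxE liftK.
Qed.

(** Discarding non-extreme generators one at a time leaves the hull unchanged and must stop. *)
Lemma conv_hull_ext (R : realType) (n k : nat) (v : 'I_k -> 'rV[R]_n) :
  exists (l : nat) (u : 'I_l -> 'rV[R]_n),
    conv_hull v = conv_hull u /\ forall j, ext (conv_hull v) (u j).
Proof.
elim: k v => [|k IHk] v; first by exists 0%N, v; split=> // -[].
have [vE|/existsNP[i nE]] := pselect (forall i, ext (conv_hull v) (v i)).
  by exists k.+1, v.
by rewrite (conv_hull_drop nE); exact: IHk.
Qed.

(** * The polar and its extreme points *)

Lemma polar_conv_hull (R : realType) (n k : nat) (v : 'I_k -> 'rV[R]_n)
    (y : 'rV[R]_n) :
  polar (conv_hull v) y <-> forall i, dot y (v i) <= 1.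
Proof.
split=> [py i|yv x vx]; first by rewrite dotC; apply/py/conv_hull_vertex.
by rewrite dotC; apply: dot_conv_hull_le vx.
Qed.

(** Two numbers at most 1 with a proper weighted mean of 1 are both 1. *)
Lemma segment_tight (R : realType) (n : nat) (C : set 'rV[R]_n)
    (y z x : 'rV[R]_n) (t : R) :
  polar C y -> polar C z -> C x -> 0 < t < 1 ->
  dot (t *: y + (1 - t) *: z) x = 1 -> dot y x = 1 /\ dot z x = 1.
Proof.
move=> Cy Cz Cx /andP[t0 t1]; rewrite dotC dotDr !dotZr => yz.
have := Cy _ Cx; have := Cz _ Cx; rewrite ![dot _ x]dotC.
by rewrite ![dot x _]dotC in yz *; split; nra.
Qed.

(* Follow [d] until a new inequality becomes tight; one does, because [0] is
   interior to the hull. *)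
Lemma polar_push (R : realType) (n k : nat) (v : 'I_k -> 'rV[R]_n)
    (y d : 'rV[R]_n) :
  interior (conv_hull v) 0 -> polar (conv_hull v) y -> d != 0 ->
  (forall i, dot y (v i) = 1 -> dot d (v i) = 0) ->
  exists s : R, [/\ 0 < s, polar (conv_hull v) (y + s *: d) &
    [set i | dot y (v i) == 1]%SET
      \proper [set i | dot (y + s *: d) (v i) == 1]%SET].
Proof.
move=> v0 /polar_conv_hull py d0 dt.
have [x vx dx] := interior0_dot_gt0 v0 d0.
have [i0 di0] := dot_conv_hull_lt vx dx.
(* The step length along [d] at which the inequality of [v i] becomes tight; the minimum over
   increasing inequalities is the first one hit. *)
pose F i := (1 - dot y (v i)) / dot d (v i).
case: (@arg_minP _ _ _ i0 (fun i => 0 < dot d (v i)) F di0) => i di Fmin.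
have dE j s : dot (y + s *: d) (v j) = dot y (v j) + s * dot d (v j).
  by rewrite dotC dotDr dotZr ![dot (v j) _]dotC.
have yi : dot y (v i) < 1.
  by rewrite lt_neqAle py andbT; apply/eqP => /dt di'; rewrite di' ltxx in di.
have s0 : 0 < F i by rewrite divr_gt0 ?subr_gt0.
exists (F i); split=> //.
- apply/polar_conv_hull => j; rewrite dE.
  have [dj|dj] := ltP 0 (dot d (v j)).
    by rewrite -lerBrDl -ler_pdivlMr//; exact: Fmin.
  by have := py j; nra.
- rewrite properE; apply/andP; split; apply/fintype.subsetP.
    move=> j; rewrite !inE dE => /eqP yj.
    by rewrite yj (dt _ yj) mulr0 addr0.
  move=> /(_ i); rewrite !inE dE divfK; last by rewrite gt_eqF.
  by rewrite addrC subrK eqxx (lt_eqF yi) => /(_ isT).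
Qed.

(* Minkowski's theorem for the polar, as an induction principle. *)
Lemma polar_ext_ind (R : realType) (n : nat) (C : set 'rV[R]_n)
    (Q : set 'rV[R]_n) :
  polytope C -> ext (polar C) `<=` Q ->
  (forall y z t, polar C y -> polar C z -> 0 < t < 1 -> Q y -> Q z ->
     Q (t *: y + (1 - t) *: z)) ->
  polar C `<=` Q.
Proof.
move=> [[k [v ->]] v0] extQ segQ y.
(* Induction on the number of inequalities that are not tight at [y]. *)
have [m] := ubnP (k - #|[set i | dot y (v i) == 1]%SET|).
elim: m y => // m IHm y; rewrite ltnS => ym py.
have [/extQ//|nE] := pselect (ext (polar (conv_hull v)) y).
have [a [b [t [pa pb t01 yE ab]]]] : exists a b t,
    [/\ polar (conv_hull v) a, polar (conv_hull v) b, 0 < t < 1,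
        y = t *: a + (1 - t) *: b & a != b].
  apply: contrapT => H; apply: nE; split=> // a b t pa pb t01 yE.
  have [ab|ab] := eqVneq a b; last by case: H; exists a, b, t.
  by rewrite yE -ab -scalerDl addrC subrK scale1r.
have push d : d != 0 -> (forall i, dot y (v i) = 1 -> dot d (v i) = 0) ->
    exists s : R, [/\ 0 < s, polar (conv_hull v) (y + s *: d) & Q (y + s *: d)].
  move=> d0 dt; have [s [s0 ps /proper_card lt]] := polar_push v0 py d0 dt.
  exists s; split=> //; apply: IHm => //; apply: leq_trans ym.
  apply: ltn_sub2l => //; apply: leq_trans lt _.
  by apply: leq_trans (max_card _) _; rewrite card_ord.
have dt i : dot y (v i) = 1 -> dot (a - b) (v i) = 0.
  rewrite yE => /(segment_tight pa pb (conv_hull_vertex v i) t01)[ai bi].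
  by rewrite dotC dotBr ![dot (v i) _]dotC ai bi subrr.
have [|//|s [s0 ps Qs]] := push (a - b); first by rewrite subr_eq0.
have [||r [r0 pr Qr]] := push (b - a).
- by rewrite subr_eq0 eq_sym.
- by move=> i /dt dab; rewrite -opprB -scaleN1r dotC dotZr dotC dab mulr0.
(* The pushes in the two opposite directions end at points with more tight inequalities, and [y]
   lies between them; the weights cancel the two displacements. *)
have -> : y = (r / (s + r)) *: (y + s *: (a - b))
    + (1 - r / (s + r)) *: (y + r *: (b - a)).
  have sr : s + r != 0 by rewrite gt_eqF// addr_gt0.
  by apply/rowP => i; rewrite !mxE; field.
apply: segQ => //; rewrite divr_gt0 ?addr_gt0//=.
by rewrite ltr_pdivrMr ?addr_gt0// mul1r ltrDr.
Qed.

(** * Faces, their vertices and the facets containing them *)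

(** Writing a point of [F] as a convex combination of extreme points of [C], tightness of the
    inequality defining [F] forces weight zero on those outside [F]. *)
Lemma face_dot_eq (R : realType) (n : nat) (C F : set 'rV[R]_n)
    (z : 'rV[R]_n) (c : R) :
  polytope C -> faces C F -> (forall x, ext C x -> F x -> dot z x = c) ->
  forall x, F x -> dot z x = c.
Proof.
move=> [[k [v CE]] _] [a [b [ab FE]]] zc x.
have [l [u [vu extu]]] := conv_hull_ext v.
have extCu j : ext C (u j) by rewrite CE.
rewrite {1}FE => -[]; rewrite CE vu => -[w [w0 w1 xE]] /= axb.
have wab j : 0 <= w 0 j * (b - dot a (u j)).
  by rewrite mulr_ge0// subr_ge0 ab//; case: (extCu j).
have sum0 : \sum_j w 0 j * (b - dot a (u j)) = 0.
  under eq_bigr => j _ do rewrite mulrBr.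
  by rewrite sumrB -mulr_suml w1 mul1r -dot_sumr -xE axb subrr.
rewrite xE dot_sumr -[RHS]mul1r -w1 mulr_suml; apply: eq_bigr => j _.
have /eqP := psumr_eq0P (fun j _ => wab j) sum0 (i := j) isT.
rewrite mulf_eq0 => /orP[/eqP->|]; first by rewrite !mul0r.
rewrite subr_eq0 => /eqP bu; congr (_ * _); apply: zc => //.
by rewrite FE; split=> //; case: (extCu j).
Qed.

(* Every face of [C] is the intersection of [C] with the facets containing it,
   where a facet is given by an extreme point of the polar. *)
Lemma face_cut_by_facets (R : realType) (n : nat) (C G : set 'rV[R]_n)
    (x : 'rV[R]_n) :
  polytope C -> faces C G -> C x ->
  (forall u, ext (polar C) u -> (forall g, G g -> dot u g = 1) ->
     dot u x = 1) ->
  G x.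
Proof.
move=> polC [a [b [ab ->]]] Cx ux; split=> //=.
have intC : interior C 0 by case: polC.
have C0 : C 0 by exact: interior_subset.
(* If [b] is 0, then [a] is 0 because 0 is interior, and the face is [C]. Otherwise scaling [b] to 1
   puts [a] in the polar. *)
have := ab _ C0; rewrite dot0r le_eqVlt => /orP[/eqP b0|b0].
  have [->|a0] := eqVneq a 0; first by rewrite dotC dot0r.
  have [y Cy] := interior0_dot_gt0 intC a0.
  by rewrite ltNge b0 ab.
have aE g : dot (b^-1 *: a) g = b^-1 * dot a g by rewrite dotC dotZr dotC.
(* [Q y]: if every facet containing the face of [C] cut out by [y] contains
   [x], then so does that face. *)
pose Q := [set y | (forall u, ext (polar C) u ->
  (forall g, C g -> dot y g = 1 -> dot u g = 1) -> dot u x = 1) ->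
  dot y x = 1].
have : Q (b^-1 *: a).
  apply: (polar_ext_ind polC).
  - by move=> y ey /(_ y ey); apply.
  - move=> y z t py pz t01 Qy Qz H.
    have tight w : (forall g, C g -> dot (t *: y + (1 - t) *: z) g = 1 ->
        dot w g = 1) -> (forall u, ext (polar C) u ->
        (forall g, C g -> dot w g = 1 -> dot u g = 1) -> dot u x = 1).
      move=> Hw u eu Hu; apply: H => // g Cg yzg.
      by apply: Hu => //; exact: Hw.
    have yx : dot y x = 1.
      by apply/Qy/tight => g Cg /(segment_tight py pz Cg t01)[].
    have zx : dot z x = 1.
      by apply/Qz/tight => g Cg /(segment_tight py pz Cg t01)[].
    by rewrite dotC dotDr !dotZr ![dot x _]dotC yx zx; ring.
  - by move=> g Cg; rewrite dotC aE mulrC ler_pdivrMr// mul1r ab.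
move=> Qa; have /Qa : forall u, ext (polar C) u ->
    (forall g, C g -> dot (b^-1 *: a) g = 1 -> dot u g = 1) -> dot u x = 1.
  move=> u eu Hu; apply: ux => // g [Cg /= ag].
  by apply: Hu => //; rewrite aE ag mulVf// gt_eqF.
by rewrite aE => /(canRL (mulVKf _)) ->; rewrite ?mulr1// gt_eqF.
Qed.

(** * From faces to subsets of indices, and the two bounds *)

(** Only extreme points count, since a factorization constrains [A] only there; on them nonzero
    entries are positive. *)
Definition face_support (R : realType) (n k : nat) (C : set 'rV[R]_n)
    (A : 'rV[R]_n -> 'rV[R]_k) (F : set 'rV[R]_n) : {set 'I_k} :=
  [set i | `[< exists x, [/\ ext C x, F x & A x 0 i != 0] >]]%SET.

Lemma face_support_sub (R : realType) (n k : nat) (C F G : set 'rV[R]_n)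
    (A B : 'rV[R]_n -> 'rV[R]_k) :
  polytope C ->
  (forall x, ext C x -> nonneg_vec (A x)) ->
  (forall y, ext (polar C) y -> nonneg_vec (B y)) ->
  (forall x y, ext C x -> ext (polar C) y -> slack x y = dot (A x) (B y)) ->
  faces C F -> faces C G ->
  face_support C A F \subset face_support C A G -> F `<=` G.
Proof.
move=> polC A0 B0 AB fF fG /fintype.subsetP FG x Fx.
apply: (face_cut_by_facets polC fG).
  by case: fF Fx => a [b [_ ->]] [].
move=> u eu Gu; apply: (face_dot_eq polC fF _ Fx) => g eg Fg.
suff : slack g u = 0 by rewrite /slack dotC => /eqP; rewrite subr_eq0 => /eqP.
rewrite AB// /dot big1// => i _.
have [->|Agi] := eqVneq (A g 0 i) 0; first by rewrite mul0r.
have /FG : i \in face_support C A F by rewrite inE; apply/asboolP; exists g.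
rewrite inE => /asboolP[h [eh Gh Ahi]].
have ABh j : 0 <= A h 0 j * B u 0 j by rewrite mulr_ge0// ?A0 ?B0.
have sum0 : \sum_j A h 0 j * B u 0 j = 0.
  by rewrite -[LHS]/(dot _ _) -AB// /slack dotC Gu// subrr.
have /eqP := psumr_eq0P (fun j _ => ABh j) sum0 (i := i) isT.
by rewrite mulf_eq0 (negPf Ahi) => /eqP->; rewrite mulr0.
Qed.

Lemma nonneg_rankP (R : realType) (n : nat) (C : set 'rV[R]_n) :
  polytope C -> nonneg_factorization C (nonneg_rank C).
Proof.
move=> /nonneg_factorization_exists[i Ci]; rewrite /nonneg_rank.
case: pselect => [h|[]]; last by exists i; apply/asboolP.
by case: ex_minnP => m /asboolP.
Qed.

Lemma faces_embedding (R : realType) (n : nat) (C : set 'rV[R]_n) :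
  polytope C -> exists f : set 'rV[R]_n -> {set 'I_(nonneg_rank C)},
    forall F G, faces C F -> faces C G -> f F \subset f G -> F `<=` G.
Proof.
move=> polC; have [A [B [A0 B0 AB]]] := nonneg_rankP polC.
by exists (face_support C A) => F G; exact: (face_support_sub polC A0 B0 AB).
Qed.

Theorem corollary4p13 (R : realType) (n : nat) (C : set 'rV[R]_n)
    (polC : polytope C) :
  (sperner_index (max_antichain C) <= nonneg_rank C)%N /\
  ln (num_faces C)%:R / ln 2 <= (nonneg_rank C)%:R :> R.
Proof.
have [f f_sub] := faces_embedding polC.
have facesE F : F \in fset_set (faces C) -> faces C F.
  by rewrite in_fset_set; [move/set_mem|exact: finite_faces].
have f_inj F G : faces C F -> faces C G -> f F = f G -> F = G.
  by move=> fF fG fFG; apply/seteqP; split; apply: f_sub; rewrite // fFG.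
split.
(* By minimality of the index, it suffices that the rank itself satisfies the binomial bound. *)
- rewrite /sperner_index; case: ex_minnP => m _; apply.
  apply/bigmax_leqP_seq => A; rewrite fpowersetE => /fsubsetP AC /asboolP antiA.
  have AE (F : A) : faces C (val F) by apply/facesE/AC/valP.
  have valf_inj : injective (fun F : A => f (val F)).
    by move=> F G /(f_inj _ _ (AE F) (AE G))/val_inj.
  rewrite cardfE -cardsT -(card_imset _ valf_inj) -[X in 'C(X, X./2)]card_ord.
  apply: sperner => _ _ /imsetP[F _ ->] /imsetP[G _ ->] FG.
  by congr f; apply: antiA; [exact: valP|exact: valP|exact: f_sub FG].
- have num_le : (num_faces C <= 2 ^ nonneg_rank C)%N.
    rewrite /num_faces cardfE -[X in (2 ^ X)%N]card_ord.
    rewrite -[X in (2 ^ X)%N]cardsT -card_powerset finset.powersetT cardsT.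
    apply: (@leq_card _ _ (fun F : fset_set (faces C) => f (val F))).
    by move=> F G /f_inj FG; apply/val_inj/FG; apply/facesE/valP.
  have ln2 : 0 < ln 2 :> R by rewrite ln_gt0// ltr1n.
  (* The case of 0 is settled by the convention that [ln] vanishes there; monotonicity of [ln]
     requires positive arguments. *)
  rewrite ler_pdivrMr//; have [->|num_gt0] := posnP (num_faces C).
    by rewrite ln0// mulr_ge0// ltW.
  rewrite mulr_natl -lnXn// ler_ln ?posrE ?exprn_gt0 ?ltr0n//.
  by rewrite -natrX ler_nat.
Qed.
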